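(* Let $G=(V,E)$ be a directed graph (an undirected graph is represented by replacing each undirected edge with one directed edge in each direction), let $x\in V$, and let $\nu,k$ be positive integers with $\nu k=O(|E|)$. Consider the randomized algorithm $\textsc{Local1+}_G(x,\nu,k)$ defined as follows. (If the minimum out-degree of $G$ is less than $k$, $k$ is first replaced by the minimum degree, and the trivial cut is returned if no smaller cut is found.) Repeat the following for $k$ iterations, always working on the current (possibly modified) graph: (1) Choose an integer $\tau$ uniformly at random from $\{1,\dots,8\nu k\}$; in the last iteration set $\tau\gets 8\nu k$ instead. Grow a depth-first-search tree $T$ from $x$; at every time step let $V(T)$ be the set of vertices visited so far, and stop the search as soon as $\mathrm{vol}^{\mathrm{out}}(V(T))\ge\tau$; let $y$ be the last vertex visited by the search. (2) If the search terminates normally (i.e. it finishes exploring everything reachable from $x$ without the stopping condition being triggered), return $V(T)$. (3) Unless this is the last iteration, reverse the direction of every edge on the unique path from $x$ to $y$ in $T$. If all $k$ iterations finish without returning, return $\bot$. Then $\textsc{Local1+}$ is a LocalEC algorithm with $(\nu k^2,\nu k^2,\nu k)$-complexity.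
   Context: For vertex sets $S,T$, $E(S,T)$ denotes the set of edges from $S$ to $T$, and $\mathrm{vol}^{\mathrm{out}}(S)=\sum_{v\in S}\deg^{\mathrm{out}}(v)$. An algorithm $\mathcal A$ is called LocalEC if, given a vertex $x$ of a graph $G=(V,E)$ and parameters $\nu,k$ with $\nu k=O(|E|)$, it either outputs a vertex set $S$ with $x\in S$ and $|E(S,V\setminus S)|<k$, or outputs the symbol $\bot$, certifying that there is no non-empty vertex set $S$ with $x\in S$, $\mathrm{vol}^{\mathrm{out}}(S)\le\nu$ and $|E(S,V\setminus S)|<k$; one-sided error is allowed: if such a set $S$ exists, $\bot$ is returned with probability at most $1/2$. A LocalEC algorithm $\mathcal A(x,\nu,k)$ has $(t,s_e,s_v)$-complexity if it terminates in $O(t)$ time, accesses at most $O(s_e)$ distinct edges, and accesses at most $O(s_v)$ distinct vertices.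
   Formalization: The trivial cut is the side containing x of a cut isolating a minimum-out-degree vertex if it has fewer than k out-edges, else all of V (the literal cut can miss x or have k or more edges in a digraph); the minimum degree and trivial cut are taken as known at unit cost. *)

(* Defs.v *)
From mathcomp Require Import all_boot all_order all_algebra.

Set Implicit Arguments.
Unset Strict Implicit.
Unset Printing Implicit Defensive.

Import Order.TTheory GRing.Theory Num.Theory.

Section Digraph.

Variables V E : finType.

(* Edges have their own identity: reversing a path of a simple digraph may
   create parallel edges, so the modified graphs are multigraphs. *)
Record digraph := Digraph { src : E -> V; dst : E -> V }.

Implicit Types (G : digraph) (S T : {set V}).

Definition out_edges G (v : V) : {set E} := [set e | src G e == v].

Definition outdeg G (v : V) : nat := #|out_edges G v|.

Definition vol_out G S : nat := \sum_(v in S) outdeg G v.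

Definition edges_between G S T : {set E} :=
  [set e | (src G e \in S) && (dst G e \in T)].

Definition cut_size G S : nat := #|edges_between G S (~: S)|.

Definition reverse_path G (p : seq E) : digraph :=
  Digraph (fun e => if e \in p then dst G e else src G e)
          (fun e => if e \in p then src G e else dst G e).

(* The vertex x only witnesses that V is not empty. *)
Definition min_outdeg G (x : V) : nat := outdeg G [arg min_(v < x) outdeg G v].

End Digraph.

Section Randomized.

(* A randomized computation: a tree whose node [draw n f] picks i uniformly
   in {0, ..., n} and continues as [f i]. *)
Inductive rand (A : Type) : Type :=
  | ret of A
  | draw (n : nat) of ('I_n.+1 -> rand A).

Fixpoint rmap (A B : Type) (g : A -> B) (c : rand A) : rand B :=
  match c with
  | ret a => ret (g a)
  | draw n f => draw (fun i => rmap g (f i))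
  end.

Fixpoint Pr (A : Type) (P : pred A) (c : rand A) : rat :=
  match c with
  | ret a => (P a)%:R%R
  | draw n f => ((\sum_(i < n.+1) Pr P (f i)) / n.+1%:R)%R
  end.

Fixpoint always (A : Type) (P : A -> Prop) (c : rand A) : Prop :=
  match c with
  | ret a => P a
  | draw n f => forall i, always P (f i)
  end.

End Randomized.

Section Runs.

Variables V E : finType.

(* The operations of a run, each of unit cost. They are accesses to the
   adjacency lists, the degrees, the marks and the tree pointers of the graph;
   [Step] is a constant amount of work that touches no edge and no vertex. *)
Inductive event : Type :=
  | AccessVertex of V
  | AccessEdge of E
  | Step.

Definition event_vertex (a : event) : option V :=
  if a is AccessVertex v then Some v else None.

Definition event_edge (a : event) : option E :=
  if a is AccessEdge e then Some e else None.

(* [answer = None] stands for the symbol bottom. *)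
Record outcome := Outcome { answer : option {set V}; trace : seq event }.

Definition run_time (o : outcome) : nat := size (trace o).

Definition accessed_edges (o : outcome) : {set E} :=
  [set e in pmap event_edge (trace o)].

Definition accessed_vertices (o : outcome) : {set V} :=
  [set v in pmap event_vertex (trace o)].

End Runs.

Arguments AccessVertex {V E}.
Arguments AccessEdge {V E}.
Arguments Step {V E}.

(* An algorithm taking a graph G, a vertex x and the parameters nu and k. A
   [None] leaf is a run that does not terminate. *)
Definition algorithm : Type :=
  forall (V E : finType),
    digraph V E -> V -> nat -> nat -> rand (option (outcome V E)).

Definition returns_bot (V E : finType) (r : option (outcome V E)) : bool :=
  if r is Some o then answer o == None else false.

Definition valid_run (V E : finType) (G : digraph V E) (x : V) (k : nat)
    (r : option (outcome V E)) : Prop :=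
  if r is Some o then
    forall S, answer o = Some S -> x \in S /\ cut_size G S < k
  else False.

(* The constant c is the one hidden in nu * k = O(|E|). *)
Definition LocalEC (c : nat) (A : algorithm) : Prop :=
  forall (V E : finType) (G : digraph V E) (x : V) (nu k : nat),
    0 < nu -> 0 < k -> nu * k <= c * #|E| ->
    always (valid_run G x k) (A V E G x nu k)
    /\ ((exists S : {set V},
           [/\ x \in S, vol_out G S <= nu & cut_size G S < k]) ->
        (Pr (@returns_bot V E) (A V E G x nu k) <= 1 / 2)%R).

Definition has_complexity (c : nat) (A : algorithm)
    (t se sv : nat -> nat -> nat) : Prop :=
  exists C : nat,
  forall (V E : finType) (G : digraph V E) (x : V) (nu k : nat),
    0 < nu -> 0 < k -> nu * k <= c * #|E| ->
    always (fun r => if r is Some o then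
                       [/\ run_time o <= C * t nu k,
                           #|accessed_edges o| <= C * se nu k &
                           #|accessed_vertices o| <= C * sv nu k]
                     else False)
           (A V E G x nu k).

(* The order in which a depth-first search scans the out-edges of a vertex of
   the current graph; it may depend on the paths reversed so far. *)
Record dfs_rule (V E : finType) := DfsRule {
  scan_order : seq (seq E) -> digraph V E -> V -> seq E;
  scan_orderP : forall h G v,
    perm_eq (scan_order h G v) (enum (out_edges G v))
}.

Section DFS.

Variables (V E : finType) (G : digraph V E) (adj : V -> seq E).
Variables (x : V) (tau : nat).

(* [visited] lists V(T), latest vertex first; [parent v] is the edge of T
   entering v; [stack] holds the unscanned out-edges of the open vertices. *)
Record dfs_state := DfsState {
  visited : seq V;
  parent : V -> option E;
  stack : seq (seq E);
  dfs_trace : seq (event V E)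
}.

Definition tree_vertices (s : dfs_state) : {set V} :=
  [set v in visited s].

Definition dfs_init : dfs_state :=
  DfsState [:: x] (fun _ => None) [:: adj x] [:: AccessVertex x].

(* A running total of the degrees of the visited vertices decides this test in
   constant time, so it is charged to the event that records the visit. *)
Definition dfs_stop (s : dfs_state) : bool :=
  tau <= vol_out G (tree_vertices s).

(* The first component of the result is the last vertex visited if the search
   was stopped, and [None] if it terminated normally; fuel exhaustion yields
   [None] as a whole. *)
Fixpoint dfs_loop (fuel : nat) (s : dfs_state) :
    option (option V * dfs_state) :=
  if fuel isn't n.+1 then None else
  match stack s with
  | [::] => Some (None, s)
  | [::] :: st =>
      dfs_loop n (DfsState (visited s) (parent s) st
                           (rcons (dfs_trace s) Step))
  | (e :: es) :: st =>
      let v := dst G e in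
      let tr := dfs_trace s ++ [:: AccessEdge e; AccessVertex v] in
      if v \in visited s then
        dfs_loop n (DfsState (visited s) (parent s) (es :: st) tr)
      else
        let s' := DfsState (v :: visited s)
                           (fun w => if w == v then Some e else parent s w)
                           [:: adj v, es & st]
                           (rcons tr Step) in
        if dfs_stop s' then Some (Some v, s') else dfs_loop n s'
  end.

(* Every edge is scanned and every vertex closed at most once, so this much
   fuel is enough. *)
Definition dfs : option (option V * dfs_state) :=
  if dfs_stop dfs_init then Some (Some x, dfs_init)
  else dfs_loop (#|V| + #|E|).+1 dfs_init.

Fixpoint climb (par : V -> option E) (n : nat) (v : V) : seq E :=
  if n isn't m.+1 then [::] else
  if par v is Some e then e :: climb par m (src G e) else [::].

(* The edges of the path of T from x to y, listed from y up to x. *)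
Definition tree_path (s : dfs_state) (y : V) : seq E :=
  climb (parent s) #|V| y.

(* Once a search ends, every vertex of T is touched again, to report it or to
   erase its mark. *)
Definition search_trace (s : dfs_state) : seq (event V E) :=
  dfs_trace s ++ [seq AccessVertex v | v <- visited s].

End DFS.

Section Local1p.

Variables (V E : finType) (R : dfs_rule V E) (x : V).

(* [n.+1] iterations remain, N = 8 nu k, h is the list of the paths reversed so
   far, G the current graph and tr the trace so far. As N > 0, the number i.+1 is
   uniform in {1, ..., N}. *)
Fixpoint local1p_loop (N n : nat) (h : seq (seq E)) (G : digraph V E)
    (tr : seq (event V E)) : rand (option (outcome V E)) :=
  let search := dfs G (scan_order R h G) x in
  match n with
  | 0 =>
      ret (if search N is Some (stopped, s) then
             Some (Outcome
               (if stopped is Some _ then None else Some (tree_vertices s))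
               (tr ++ search_trace s))
           else None)
  | n'.+1 =>
      draw (fun i : 'I_N.-1.+1 =>
        let tr1 := rcons tr Step in
        match search i.+1 with
        | None => ret None
        | Some (None, s) =>
            ret (Some (Outcome (Some (tree_vertices s))
                               (tr1 ++ search_trace s)))
        | Some (Some y, s) =>
            let p := tree_path G s y in
            local1p_loop N n' (p :: h) (reverse_path G p)
              (tr1 ++ search_trace s ++ [seq AccessEdge e | e <- p])
        end)
  end.

Definition local1p_core (G : digraph V E) (nu k : nat) :
    rand (option (outcome V E)) :=
  if k is n.+1 then local1p_loop (8 * nu * k) n [::] G [::]
  else ret (Some (Outcome None [::])).

(* The side of the cut {v} | V \ {v} that contains x. *)
Definition trivial_side (v : V) : {set V} :=
  if v == x then [set x] else ~: [set v].

(* The cut isolating a vertex of minimum degree, seen from x. If G is symmetric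
   then the first case always applies. If G is not, then all the vertices v of
   minimum out-degree may differ from x and have at least k in-edges, so that no
   such cut has x on its source side and fewer than k edges; the whole vertex
   set, which no edge leaves, is used then. *)
Definition trivial_cut (G : digraph V E) (k : nat) : {set V} :=
  if [pick v | (outdeg G v == min_outdeg G x)
               && (cut_size G (trivial_side v) < k)] is Some v
  then trivial_side v else setT.

Definition or_trivial (S : {set V}) (r : option (outcome V E)) :
    option (outcome V E) :=
  omap (fun o => Outcome (Some (odflt S (answer o))) (rcons (trace o) Step)) r.

(* The minimum out-degree and the trivial cut are taken as known parameters of
   the input graph, at unit cost. *)
Definition local1p_graph (G : digraph V E) (nu k : nat) :
    rand (option (outcome V E)) :=
  let d := min_outdeg G x in
  if d < k then rmap (or_trivial (trivial_cut G k)) (local1p_core G nu d)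
  else local1p_core G nu k.

End Local1p.

Definition Local1p (R : forall V E : finType, dfs_rule V E) : algorithm :=
  fun V E G x nu k => local1p_graph (R V E) x G nu k.

(* Main.v *)
Require Import Defs.
From mathcomp Require Import all_boot all_order all_algebra.
From mathcomp Require Import zify.

(* Reversing a path that starts at x in S lowers the number of edges leaving S
   by one if the path ends outside S and keeps it otherwise. A search that ends
   normally returns a set which no edge of the current graph leaves, so after
   at most k - 1 reversals it has fewer than k edges leaving it in G.
   Conversely, let S be a cut with fewer than k edges and volume at most nu. If
   every search stops outside S, then S is closed at the last iteration, whose
   search cannot reach the volume 8 nu k. A uniform threshold stops the search
   at v with probability at most outdeg v / (8 nu k), hence inside S with
   probability at most 1 / (8 k), and a union bound over the k - 1 first
   iterations bounds the failure probability by 1/8.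
   For the complexity, a search scans only edges leaving vertices of total
   volume below 8 nu k. Reversals never lower the out-degree of a vertex other
   than x, so these vertices keep out-degree at least k and each search visits
   only O(nu) of them. *)

Set Implicit Arguments.
Unset Strict Implicit.
Unset Printing Implicit Defensive.

Import Order.TTheory GRing.Theory Num.Theory.

(** * Reversing paths *)

Section Graphs.

Variables V E : finType.
Implicit Types (G : digraph V E) (S : {set V}) (p : seq E) (l : seq V).

(** Edges are listed from the end [v] back to [x], the order in which [climb] produces them. *)
Fixpoint walk_up G (x : V) p (v : V) : Prop :=
  if p is e :: p' then dst G e = v /\ walk_up G x p' (src G e) else v = x.

(* A cut size or a volume is a sum of weights f (src e) (dst e) in which
   reversing an edge from a to b adds h b - h a, so the changes along a path
   telescope. *)
Lemma sum_reverse_path G x y p (f : V -> V -> nat) (h : V -> nat) :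
    (forall a b, f b a + h a = f a b + h b) ->
    walk_up G x p y -> uniq p ->
  \sum_e f (src (reverse_path G p) e) (dst (reverse_path G p) e) + h x =
  \sum_e f (src G e) (dst G e) + h y.
Proof.
move=> fh; elim: p y => [|e p IHp] y /=; first by move->.
move=> [<- wp] /andP[ep up]; have {IHp} := IHp _ wp up.
(* As [e] is not in [p], both sums of the induction hypothesis carry its unreversed weight. With
   that term isolated, [fh] at [e] closes the step. *)
rewrite (bigD1 e) //= (negbTE ep).
rewrite [X in _ -> X + _ = _](bigD1 e) //= mem_head.
rewrite [X in _ -> _ + X + _ = _](eq_bigr (fun e' =>
  f (if e' \in p then dst G e' else src G e')
    (if e' \in p then src G e' else dst G e'))); last first.
  by move=> e' /negbTE e'e; rewrite in_cons e'e.
have := fh (src G e) (dst G e).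
set a := f _ _; set b := f _ _; set s1 := \sum_(i | i != e) _.
set s2 := \sum_e0 _; lia.
Qed.

Lemma cut_sizeE G S :
  cut_size G S = \sum_e (src G e \in S) && (dst G e \notin S).
Proof.
rewrite /cut_size cardE -sum1_size big_enum sum1dep_card /=.
rewrite -sum1dep_card big_mkcond /=; apply: eq_bigr => e _.
by rewrite !inE; case: ifP.
Qed.

Lemma outdegE G v : outdeg G v = \sum_e (src G e == v).
Proof.
by rewrite /outdeg -sum1dep_card big_mkcond; apply: eq_bigr => e _; case: eqP.
Qed.

Lemma vol_outE G S : vol_out G S = \sum_e (src G e \in S).
Proof.
rewrite /vol_out (eq_bigr _ (fun v _ => outdegE G v)) exchange_big /=.
apply: eq_bigr => e _; have [eS|eS] := boolP (src G e \in S).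
  rewrite (bigD1 (src G e)) //= eqxx big1 // => v /andP[_].
  by rewrite eq_sym => /negbTE->.
by rewrite big1 // => v vS; case: eqP => // ev; rewrite ev vS in eS.
Qed.

Lemma cut_size_reverse G S x y p : walk_up G x p y -> uniq p ->
  cut_size (reverse_path G p) S + (x \in S) = cut_size G S + (y \in S).
Proof.
move=> wp up; rewrite !cut_sizeE.
apply: (sum_reverse_path (f := fun a b => (a \in S) && (b \notin S) : nat)
  (h := fun a => (a \in S) : nat) _ wp up) => a b.
by case: (a \in S); case: (b \in S).
Qed.

Lemma outdeg_reverse G v x y p : walk_up G x p y -> uniq p ->
  outdeg (reverse_path G p) v + (x == v) = outdeg G v + (y == v).
Proof.
move=> wp up; rewrite !outdegE.
by apply: (sum_reverse_path (f := fun a _ => (a == v) : nat)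
  (h := fun a => (a == v) : nat) _ wp up) => a b; rewrite addnC.
Qed.

Lemma vol_out_reverse G S x y p : walk_up G x p y -> uniq p ->
  vol_out (reverse_path G p) S + (x \in S) = vol_out G S + (y \in S).
Proof.
move=> wp up; rewrite !vol_outE.
by apply: (sum_reverse_path (f := fun a _ => (a \in S) : nat)
  (h := fun a => (a \in S) : nat) _ wp up) => a b; rewrite addnC.
Qed.

Lemma vol_out_seq G l : uniq l ->
  vol_out G [set v in l] = \sum_(v <- l) outdeg G v.
Proof.
by move=> ul; rewrite big_uniq //=; apply: eq_bigl => v; rewrite inE.
Qed.

Lemma vol_out_sub G S S' : S \subset S' -> vol_out G S <= vol_out G S'.
Proof.
move=> sSS'; rewrite !vol_outE; apply: leq_sum => e _.
by have := subsetP sSS' (src G e); case: (_ \in S) => // ->.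
Qed.

Lemma sum_outdeg G : \sum_v outdeg G v = #|E|.
Proof.
have -> : \sum_v outdeg G v = vol_out G setT.
  by apply: eq_bigl => v; rewrite inE.
by rewrite vol_outE -sum1_card; apply: eq_bigr => e; rewrite inE.
Qed.

Lemma cut_size0P G S :
  reflect (forall e, src G e \in S -> dst G e \in S) (cut_size G S == 0).
Proof.
rewrite cards_eq0; apply: (iffP eqP) => [/setP cut0 e eS|closed].
  by have := cut0 e; rewrite !inE eS /= => /negbFE.
by apply/setP => e; rewrite !inE; apply/negP => /andP[/closed ->].
Qed.

Lemma min_outdeg_le G x v : min_outdeg G x <= outdeg G v.
Proof. by rewrite /min_outdeg; case: arg_minnP => // u _; apply. Qed.

End Graphs.

(** * Depth-first search *)

Section DepthFirstSearch.

Variables (V E : finType) (G : digraph V E) (adj : V -> seq E) (x : V).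
Hypothesis adjP : forall v, perm_eq (adj v) (enum (out_edges G v)).

Notation state := (dfs_state V E).
Implicit Types (s : state) (l : seq V) (par : V -> option E).

Lemma size_adj v : size (adj v) = outdeg G v.
Proof. by rewrite (perm_size (adjP v)) -cardE. Qed.

Lemma mem_adj v e : (e \in adj v) = (src G e == v).
Proof. by rewrite (perm_mem (adjP v)) mem_enum inE. Qed.

(** The latest vertex comes first, so every parent lies in the tail; induction on the list is then
    induction on the tree. *)
Fixpoint search_tree par l : Prop :=
  if l is v :: l' then
    if l' is [::] then v = x /\ par v = None
    else (exists e, [/\ par v = Some e, dst G e = v & src G e \in l'])
         /\ search_tree par l'
  else False.

Lemma search_tree_eq par par' l :
  {in l, par =1 par'} -> search_tree par l -> search_tree par' l.
Proof.
elim: l => [|v [|u l] IHl] //= eq_par.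
  by rewrite -eq_par ?mem_head.
rewrite -eq_par ?mem_head // => -[ex_e tree_l]; split => //.
by apply: IHl tree_l => w wl; apply: eq_par; rewrite in_cons wl orbT.
Qed.

Lemma search_tree_root par l : search_tree par l -> x \in l.
Proof.
elim: l => [|v [|u l] IHl] //= [].
  by move=> <-; rewrite mem_head.
by move=> _ /IHl xl; rewrite in_cons xl orbT.
Qed.

Lemma search_tree_closed par l (S : {set V}) :
  search_tree par l -> x \in S -> cut_size G S = 0 -> {subset l <= S}.
Proof.
move=> tree_l xS /eqP/cut_size0P closed.
elim: l tree_l => [|v [|u l] IHl] //=.
  by move=> [-> _] w; rewrite inE => /eqP->.
move=> [[e [_ <- el]] tree_l] w; rewrite in_cons => /predU1P[->|wl].
  by apply/closed/IHl.
exact: IHl.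
Qed.

(** Each step moves strictly down the duplicate-free list, so the heads of the path edges are
    distinct and [size l] units of fuel suffice. Distinct heads in [l] give a duplicate-free path no
    longer than [l]. *)
Lemma climb_spec par l v n : uniq l -> search_tree par l -> v \in l ->
    size l <= n ->
  let p := climb G par n v in
  [/\ walk_up G x p v, uniq (map (dst G) p) & {subset map (dst G) p <= l}].
Proof.
elim: l v n => [|v0 [|u l] IHl] // v [|n] //=.
  by move=> _ [-> par0]; rewrite inE => /eqP-> _; rewrite par0.
move=> /andP[v0l ul] [[e [par0 de se]] tree_l]; rewrite in_cons.
case/predU1P => [->|vl] size_l.
  rewrite par0 /=; have [wp up sp] := IHl _ n ul tree_l se size_l.
  split=> [//||w]; first rewrite up andbT de; first exact: contra (sp _) v0l.
  by rewrite !in_cons de => /predU1P[->|/sp]; rewrite ?eqxx //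
     !in_cons => ->; rewrite orbT.
have [wp up sp] := IHl _ n.+1 ul tree_l vl (leq_trans (leqnSn _) size_l).
by split=> // w /sp wl; rewrite in_cons wl orbT.
Qed.

(** Termination measure: an unvisited vertex may still cost one unit of fuel per out-edge and one
    for popping its emptied list. *)
Definition unvisited_cost l := \sum_(v | v \notin l) (outdeg G v).+1.

Lemma unvisited_cost_cons l (v : V) : v \notin l ->
  unvisited_cost l = (outdeg G v).+1 + unvisited_cost (v :: l).
Proof.
move=> vl; rewrite /unvisited_cost (bigD1 v) //=; congr (_ + _).
by apply: eq_bigl => w; rewrite in_cons negb_or andbC.
Qed.

Lemma unvisited_cost_nil : unvisited_cost [::] = #|V| + #|E|.
Proof.
rewrite /unvisited_cost (eq_bigr (fun v => 1 + outdeg G v)) // big_split /=.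
by rewrite sum_outdeg sum1_card.
Qed.

(* In [inv_time], a scanned edge accounts for at most three events and a visited
   vertex for its first access and the [Step] that closes it. *)
Record dfs_inv s : Prop := DfsInv {
  inv_uniq : uniq (visited s);
  inv_tree : search_tree (parent s) (visited s);
  inv_stack : forall e, e \in flatten (stack s) -> src G e \in visited s;
  inv_closed : forall e, src G e \in visited s ->
    (dst G e \in visited s) || (e \in flatten (stack s));
  inv_time : size (dfs_trace s) + 3 * size (flatten (stack s)) + size (stack s)
    <= 3 * \sum_(v <- visited s) outdeg G v + 2 * size (visited s);
  inv_vertices : {subset pmap (@event_vertex V E) (dfs_trace s) <= visited s}
}.

(** The stopping vertex is split off from [l]: its out-edges are still unscanned, so [post_time]
    does not charge its degree, which may exceed [tau]. *)
Record dfs_post (tau : nat) (o : option V) s : Prop := DfsPost {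
  post_inv : dfs_inv s;
  post_time : size (dfs_trace s) <= 3 * tau + 2 * size (visited s);
  post_stop : if o is Some y then exists l,
      [/\ visited s = y :: l, \sum_(v <- l) outdeg G v < tau
        & tau <= \sum_(v <- y :: l) outdeg G v]
    else \sum_(v <- visited s) outdeg G v < tau
         /\ cut_size G (tree_vertices s) = 0
}.

Lemma dfs_loop_spec tau n s :
    dfs_inv s -> \sum_(v <- visited s) outdeg G v < tau ->
    size (flatten (stack s)) + size (stack s)
      + unvisited_cost (visited s) < n ->
  exists o s', dfs_loop G adj tau n s = Some (o, s') /\ dfs_post tau o s'.
Proof.
elim: n s => // n IHn [vis par st tr] inv; case: (inv).
rewrite /= => uvis tree_vis st_vis closed time vert vol_tau.
case: st => [|[|e es] st] /= in inv st_vis closed time *.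
- exists None; eexists; split; first by [].
  split=> //=; first by lia.
  split=> //; apply/eqP/cut_size0P => e; rewrite !inE => /closed.
  by rewrite orbF.
- move=> fuel; apply: IHn => //=.
    split=> //=; first by rewrite size_rcons; lia.
    by move=> v; rewrite -cats1 pmap_cat cats0; apply: vert.
  by move: fuel; rewrite addnS.
set v := dst G e => fuel; have [v_vis|v_new] := boolP (v \in vis).
  apply: IHn => //=.
  split=> //=.
  - by move=> e' ?; apply: st_vis; rewrite in_cons; apply/orP; right.
  - move=> e' /closed; rewrite in_cons; case: eqP => [->|//].
    by rewrite v_vis.
  - by rewrite size_cat /=; lia.
  - by move=> w; rewrite pmap_cat mem_cat /= inE => /orP[/vert//|/eqP->].
set s' := DfsState _ _ _ _.
have inv' : dfs_inv s'.
  split=> /=.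
  - by rewrite v_new.
  - case: vis tree_vis {inv uvis st_vis closed time vert vol_tau fuel s'} v_new
        (st_vis e (mem_head _ _)) => [//|u vis] tree_vis v_new e_vis.
    split; first by exists e; rewrite eqxx.
    apply: search_tree_eq tree_vis => w w_vis; case: eqP => // wv.
    by rewrite -wv w_vis in v_new.
  - move=> e'; rewrite mem_cat mem_adj in_cons => /orP[->//|e'st].
    by rewrite st_vis ?orbT // in_cons e'st orbT.
  - move=> e'; rewrite !in_cons mem_cat mem_adj.
    case: (src G e' =P v) => [|_ /closed]; first by rewrite orbT.
    rewrite in_cons; case: (e' =P e) => [->|_ ]; first by rewrite eqxx.
    by case/orP => ->; rewrite !orbT.
  - by move: time; rewrite size_rcons !size_cat big_cons size_adj /=; lia.
  - move=> w; rewrite -cats1 !pmap_cat !mem_cat /= !inE orbF.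
    by case/orP => [/vert|] ->; rewrite ?orbT.
rewrite /dfs_stop /tree_vertices vol_out_seq; last exact: inv_uniq inv'.
case: leqP => vol_v.
  exists (Some v), s'; split=> //; split=> //.
    have := inv_time inv'; rewrite /= size_cat big_cons size_adj.
    by lia.
  by exists vis.
apply: IHn => //=.
(* Pushing [adj v] is paid by the term of [v] in [unvisited_cost]; the scanned edge gives the strict
   decrease. *)
rewrite size_cat size_adj; move: fuel; rewrite (unvisited_cost_cons v_new).
by lia.
Qed.

Lemma dfs_init_inv : dfs_inv (dfs_init adj x).
Proof.
split=> //=.
- by move=> e; rewrite cats0 mem_adj inE.
- by move=> e; rewrite cats0 mem_adj !inE => ->; rewrite orbT.
- by rewrite cats0 big_seq1 size_adj; lia.
Qed.

Lemma dfs_spec tau : 0 < tau ->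
  exists o s, Defs.dfs G adj x tau = Some (o, s) /\ dfs_post tau o s.
Proof.
move=> tau_gt0; have inv0 := dfs_init_inv.
rewrite /Defs.dfs /dfs_stop /tree_vertices vol_out_seq //.
case: leqP => vol_x.
  exists (Some x), (dfs_init adj x); split=> //; split=> //.
    by rewrite /=; lia.
  by exists [::]; rewrite big_nil.
apply: dfs_loop_spec => //=.
(* The list pushed for [x] and the unvisited vertices together cost exactly [#|V| + #|E|]. *)
rewrite cats0 size_adj -unvisited_cost_nil (@unvisited_cost_cons [::] x isT).
by lia.
Qed.

(** * Dependence of the search on its threshold *)

Lemma dfs_loop_suffix tau n s o s' :
  dfs_loop G adj tau n s = Some (o, s') -> suffix (visited s) (visited s').
Proof.
elim: n s => // n IHn [vis par [|[|e es] st] tr] /=.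
- by case=> _ <-; apply: suffix_refl.
- by move/IHn.
case: ifP => _; first by move/IHn.
case: ifP => _; first by case=> _ <-; apply: suffix_cons.
by move/IHn; apply: suffix_trans; apply: suffix_cons.
Qed.

(** Both runs share their states until the smaller threshold stops one; the other then only adds
    vertices in front. *)
Lemma dfs_loop_mono tau tau' n s o s1 o' s2 : tau <= tau' ->
    dfs_loop G adj tau n s = Some (o, s1) ->
    dfs_loop G adj tau' n s = Some (o', s2) ->
  suffix (visited s1) (visited s2).
Proof.
move=> le_tau; elim: n s => // n IHn [vis par [|[|e es] st] tr] /=.
- by case=> _ <- [_ <-]; apply: suffix_refl.
- exact: IHn.
case: ifP => _; first exact: IHn.
set s' := DfsState _ _ _ _; rewrite /dfs_stop.
case: leqP => [_ [_ <-]|lt_tau].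
  case: leqP => _; last by move/dfs_loop_suffix.
  by case=> _ <-; apply: suffix_refl.
by rewrite leqNgt (leq_trans lt_tau le_tau) /=; apply: IHn.
Qed.

Lemma dfs_mono tau tau' o s o' s' : tau <= tau' ->
    Defs.dfs G adj x tau = Some (o, s) ->
    Defs.dfs G adj x tau' = Some (o', s') ->
  suffix (visited s) (visited s').
Proof.
move=> le_tau; rewrite /Defs.dfs /dfs_stop.
case: leqP => [_ [_ <-]|lt_tau].
  case: leqP => _; last by move/dfs_loop_suffix.
  by case=> _ <-; apply: suffix_refl.
by rewrite leqNgt (leq_trans lt_tau le_tau); apply: dfs_loop_mono.
Qed.

Definition stops_in (S : {set V}) tau : bool :=
  if Defs.dfs G adj x tau is Some (Some y, _) then y \in S else false.

Lemma sum_interval a b N : \sum_(i < N) (a <= i < a + b) <= b.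
Proof.
(* Counting only the part of the interval below [N] makes the bound inductive. *)
suff: \sum_(i < N) (a <= i < a + b) <= minn b (N - a).
  by rewrite leq_min => /andP[].
elim: N => [|N IHN]; first by rewrite big_ord0.
rewrite big_ord_recr; apply: leq_trans (leq_add IHN (leqnn _)) _.
by case: (boolP (a <= N < a + b)) => /= ?; lia.
Qed.

(* The vertices visited before the search with threshold N reaches y do not
   depend on the threshold, so the thresholds that stop at y are consecutive. *)
Lemma sum_stops_at y N : \sum_(i < N) stops_in [set y] i.+1 <= outdeg G y.
Proof.
case: N => [|N]; first by rewrite big_ord0.
have [o [s [dfsN /post_inv/inv_uniq us]]] := dfs_spec (ltn0Sn N).
(* For a visited [y], [a] is the volume preceding it in the run with threshold [N.+1]. Stopping at
   [y] requires [a < i.+1 <= a + outdeg G y], which is the half-open interval for [i] below. *)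
pose a := \sum_(v <- drop (index y (visited s)).+1 (visited s)) outdeg G v.
apply: leq_trans (sum_interval a (outdeg G y) N.+1); apply: leq_sum => i _.
rewrite /stops_in; have [o' [s' [dfsi [_ _ stop]]]] := dfs_spec (ltn0Sn i).
rewrite dfsi; case: o' stop dfsi => [z|//] [l [vis_s' lt_i le_i]] dfsi.
rewrite inE; case: eqP => // zy; rewrite {z}zy in vis_s' le_i dfsi *.
have /suffixP[l' vis_s] := dfs_mono (ltn_ord i) dfsi dfsN.
suff la : \sum_(v <- l) outdeg G v = a.
  by rewrite -la; move: lt_i le_i; rewrite big_cons => ? ?; lia.
rewrite vis_s' in vis_s; rewrite /a vis_s; congr (\sum_(v <- _) _).
move: us; rewrite vis_s cat_uniq /= => /and3P[_ /norP[yl' _] _].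
rewrite index_cat (negbTE yl') /= eqxx addn0 -cat_rcons.
by rewrite drop_size_cat ?size_rcons.
Qed.

(** Stopping in [S] means stopping at one of its vertices, so the bounds for single vertices add
    up. *)
Lemma sum_stops_in (S : {set V}) N :
  \sum_(i < N) stops_in S i.+1 <= vol_out G S.
Proof.
apply: leq_trans (leq_sum _ (fun y _ => sum_stops_at y N)).
rewrite exchange_big /=; apply: leq_sum => i _; rewrite /stops_in.
case: Defs.dfs => [[[y|] s]|] //; case: (boolP (y \in S)) => // yS.
by rewrite (bigD1 y) //= set11.
Qed.

(** * Path length and cost of one search *)

Lemma tree_pathP tau y s : dfs_post tau (Some y) s ->
  [/\ walk_up G x (tree_path G s y) y, uniq (tree_path G s y)
    & size (tree_path G s y) <= size (visited s)].
Proof.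
move=> [[uvis tree_vis _ _ _ _] _ [l [vis_s _ _]]].
have y_vis : y \in visited s by rewrite vis_s mem_head.
have size_vis : size (visited s) <= #|V|.
  by rewrite -(card_uniqP uvis) max_card.
have [wp up sp] := climb_spec uvis tree_vis y_vis size_vis.
split=> //; first exact: map_uniq up.
by rewrite -(size_map (dst G)) uniq_leq_size.
Qed.

(** The vertex [x] is excepted because reversals may lower its out-degree; the predecessor discounts
    it. *)
Lemma size_vol_seq k l : (forall v, v != x -> k <= outdeg G v) -> uniq l ->
  (size l).-1 * k <= \sum_(v <- l) outdeg G v.
Proof.
move=> deg_k ul; apply: (@leq_trans (\sum_(v <- l) (v != x) * k)).
  have count_x : \sum_(v <- l) (v != x) = count (predC (pred1 x)) l.
    rewrite -sum1_count [RHS]big_mkcond /=.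
    by apply: eq_bigr => v _; case: (v == x).
  have := count_predC (pred1 x) l; rewrite -big_distrl count_x leq_mul2r /=.
  by rewrite count_uniq_mem //; case: (x \in l); lia.
by apply: leq_sum => v _; case: (boolP (v == x)) => [//|/deg_k]; rewrite ?mul1n.
Qed.

Lemma size_visited nu k tau o s : 0 < k ->
    (forall v, v != x -> k <= outdeg G v) -> tau <= 8 * nu * k ->
  dfs_post tau o s -> size (visited s) <= (8 * nu).+1.
Proof.
move=> k_gt0 deg_k le_tau [[uvis _ _ _ _ _] _ stop].
(* If the search stopped, [l] omits the stopping vertex, which the final successor counts. The
   strict volume bound absorbs [x]. *)
suff [l [ul vol_l size_l]] : exists l, [/\ uniq l,
    \sum_(v <- l) outdeg G v < tau & size (visited s) <= (size l).+1].
  have := leq_ltn_trans (size_vol_seq deg_k ul) (leq_trans vol_l le_tau).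
  by rewrite ltn_mul2r k_gt0 /=; lia.
case: o stop => [y [l [vis_s vol_l _]]|[vol_vis _]].
  by exists l; rewrite vis_s in uvis *; case/andP: uvis.
by exists (visited s).
Qed.

(** The added [size (visited s)] pays for reversing the path, the successor for drawing the
    threshold. The total is at most [24 * nu * k + 4 * (8 * nu).+1 + 1]. *)
Lemma size_search_trace nu k tau o s : 0 < nu -> 0 < k ->
    (forall v, v != x -> k <= outdeg G v) -> tau <= 8 * nu * k ->
  dfs_post tau o s ->
  (size (search_trace s) + size (visited s)).+1 <= 64 * nu * k.
Proof.
move=> nu_gt0 k_gt0 deg_k le_tau post.
have size_vis := size_visited k_gt0 deg_k le_tau post.
rewrite /search_trace size_cat size_map; have := post_time post.
have : nu <= nu * k by rewrite leq_pmulr.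
by lia.
Qed.

Lemma search_trace_vertices tau o s : dfs_post tau o s ->
  {subset pmap (@event_vertex V E) (search_trace s) <= visited s}.
Proof.
move=> [[_ _ _ _ _ vert] _ _] v; rewrite pmap_cat mem_cat => /orP[/vert//|].
by rewrite (map_pK (g := AccessVertex)).
Qed.

End DepthFirstSearch.

(** * The iterated search *)

Section Computations.

Variables A B : Type.

Lemma always_impl (P Q : A -> Prop) (c : rand A) :
  (forall a, P a -> Q a) -> always P c -> always Q c.
Proof. by move=> PQ; elim: c => [a|n f IHf] /=; [apply: PQ | eauto]. Qed.

Lemma always_rmap (P : B -> Prop) (g : A -> B) (c : rand A) :
  always (fun a => P (g a)) c -> always P (rmap g c).
Proof. by elim: c => [a|n f IHf] //= Pf i; apply: IHf. Qed.

Lemma Pr_le1 (P : pred A) (c : rand A) : (Pr P c <= 1)%R.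
Proof.
elim: c => [a|n f IHf] /=; first by case: (P a).
rewrite ler_pdivrMr ?ltr0n // mul1r.
apply: le_trans (ler_sum _ (fun i _ => IHf i)) _.
by rewrite sumr_const card_ord.
Qed.

Lemma Pr_rmap0 (P : pred B) (g : A -> B) (c : rand A) :
  (forall a, ~~ P (g a)) -> Pr P (rmap g c) = 0%R.
Proof.
move=> notP; elim: c => [a|n f IHf] /=; first by rewrite (negbTE (notP a)).
by rewrite big1 ?mul0r.
Qed.

End Computations.

Section MainLoop.

Variables (V E : finType) (R : dfs_rule V E) (x : V).
Implicit Types (G : digraph V E) (S : {set V}).

Definition vertices_of (tr : seq (event V E)) : {set V} :=
  [set v in pmap (@event_vertex V E) tr].

Lemma vertices_of_cat tr1 tr2 :
  vertices_of (tr1 ++ tr2) = vertices_of tr1 :|: vertices_of tr2.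
Proof. by apply/setP => v; rewrite !inE pmap_cat mem_cat. Qed.

Lemma vertices_of_rcons tr : vertices_of (rcons tr Step) = vertices_of tr.
Proof. by apply/setP => v; rewrite -cats1 !inE pmap_cat cats0. Qed.

Lemma vertices_of_edges p : vertices_of (map AccessEdge p) = set0.
Proof. by apply/setP => v; rewrite !inE; elim: p. Qed.

Lemma card_accessed_edges (o : outcome V E) : #|accessed_edges o| <= run_time o.
Proof.
rewrite /accessed_edges /run_time cardsE; apply: leq_trans (card_size _) _.
by rewrite size_pmap count_size.
Qed.

Lemma card_search_vertices nu k G tau o s : 0 < k ->
    (forall v, v != x -> k <= outdeg G v) -> tau <= 8 * nu * k ->
  dfs_post G x tau o s -> #|vertices_of (search_trace s)| <= (8 * nu).+1.
Proof.
move=> k_gt0 deg_k le_tau post.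
apply: leq_trans (size_visited k_gt0 deg_k le_tau post).
apply: leq_trans (card_size (visited s)); apply: subset_leq_card.
by apply/subsetP => v; rewrite inE => /(search_trace_vertices post).
Qed.

(** Relative to the current graph and trace, so that it passes through the recursion; [n] counts the
    reversals still possible, each hiding at most one cut edge. *)
Definition loop_outcome G tr nu k n (r : option (outcome V E)) : Prop :=
  if r is Some o then
    [/\ run_time o <= size tr + n.+1 * (64 * nu * k),
        #|accessed_vertices o| <= #|vertices_of tr| + n.+1 * (8 * nu).+1
      & forall S, answer o = Some S -> x \in S /\ cut_size G S <= n]
  else False.

Lemma tree_vertices_root G tau o s : dfs_post G x tau o s ->
  x \in tree_vertices s.
Proof. by case=> [[_ /search_tree_root xs _ _ _ _] _ _]; rewrite inE. Qed.

(** Serves both the last iteration and a normal end before it; in the latter case [tr1] has the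
    extra [Step] of the draw. *)
Lemma loop_outcome_return G tr tr1 nu k n tau (o : option V) s :
    size tr1 <= (size tr).+1 -> vertices_of tr1 = vertices_of tr ->
    0 < nu -> 0 < k ->
    (forall v, v != x -> k <= outdeg G v) -> tau <= 8 * nu * k ->
    dfs_post G x tau o s ->
  loop_outcome G tr nu k n (Some (Outcome
    (if o is Some _ then None else Some (tree_vertices s))
    (tr1 ++ search_trace s))).
Proof.
move=> size_tr1 vert_tr1 nu_gt0 k_gt0 deg_k le_tau post; split.
- rewrite /run_time size_cat mulSn.
  by have := size_search_trace nu_gt0 k_gt0 deg_k le_tau post; lia.
- rewrite -[accessed_vertices _]/(vertices_of _) vertices_of_cat vert_tr1.
  apply: leq_trans (leq_card_setU _ _) _; rewrite leq_add2l mulSn.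
  apply: leq_trans (leq_addr _ _).
  exact: card_search_vertices k_gt0 deg_k le_tau post.
- case: o post => // post _ [<-]; split; first exact: tree_vertices_root post.
  by have [_ ->] := post_stop post.
Qed.

Lemma local1p_loop_always nu k n h G tr : 0 < nu -> 0 < k ->
    (forall v, v != x -> k <= outdeg G v) ->
  always (loop_outcome G tr nu k n) (local1p_loop R x (8 * nu * k) n h G tr).
Proof.
move=> nu_gt0 k_gt0; have N_gt0 : 0 < 8 * nu * k by rewrite !muln_gt0 nu_gt0.
elim: n h G tr => [|n IHn] h G tr deg_k /=.
  have [o [s [-> post]]] := dfs_spec x (scan_orderP R h G) N_gt0.
  exact: loop_outcome_return (leqnSn _) erefl nu_gt0 k_gt0 deg_k (leqnn _) post.
move=> i; have le_i : i < 8 * nu * k by rewrite -[X in _ < X](prednK N_gt0).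
have [o [s [-> post]]] := dfs_spec x (scan_orderP R h G) (ltn0Sn i).
case: o post => [y|] post /=; last first.
  apply: (loop_outcome_return n.+1 _ (vertices_of_rcons tr) nu_gt0 k_gt0 deg_k
    le_i post).
  by rewrite size_rcons.
have [wp up size_p] := tree_pathP post.
set p := tree_path G s y in wp up size_p *.
apply: always_impl (IHn _ _ _ _) => [[o|//] [time vert cut]|v vx]; last first.
  by have := outdeg_reverse v wp up; have := deg_k _ vx;
     rewrite [x == v]eq_sym (negbTE vx); lia.
split=> [||S /cut[xS cut_S]].
- have := size_search_trace nu_gt0 k_gt0 deg_k le_i post.
  by move: time; rewrite !size_cat size_rcons !size_map [n.+2 * _]mulSn; lia.
- apply: leq_trans vert _; rewrite [n.+2 * _]mulSn addnA leq_add2r.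
  rewrite vertices_of_cat (vertices_of_cat (search_trace s)).
  rewrite vertices_of_edges vertices_of_rcons setU0.
  apply: leq_trans (leq_card_setU _ _) _; rewrite leq_add2l.
  exact: card_search_vertices k_gt0 deg_k le_i post.
- by split=> //; have := cut_size_reverse S wp up; rewrite xS; lia.
Qed.

Lemma Pr_local1p_loop nu N n h G tr S : nu < N -> x \in S ->
    vol_out G S <= nu -> cut_size G S <= n ->
  (Pr (@returns_bot V E) (local1p_loop R x N n h G tr)
     <= (n * nu)%:R / N%:R)%R.
Proof.
case: N => // N lt_nu xS; elim: n h G tr => [|n IHn] h G tr vol_S /=.
  rewrite leqn0 => /eqP cut_S; rewrite mul0n mul0r.
  have [o [s [-> post]]] := dfs_spec x (scan_orderP R h G) (ltn0Sn N).
  case: o post => [y|] post //=; have [inv _ [l [vis_s _]]] := post.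
  rewrite -vis_s -vol_out_seq ?(inv_uniq inv) // leqNgt.
  have sub_S := search_tree_closed (inv_tree inv) xS cut_S.
  rewrite (leq_ltn_trans _ (leq_ltn_trans vol_S lt_nu)) // vol_out_sub //.
  by apply/subsetP => v; rewrite inE => /sub_S.
move=> cut_S; rewrite ler_wpM2r ?invr_ge0 ?ler0n //.
(* A stop inside [S] is bounded by probability 1. After a stop outside, the cut and the volume of
   [S] have both dropped by one, so the induction hypothesis applies. *)
have step (i : 'I_N.+1) : (Pr (@returns_bot V E)
    match Defs.dfs G (scan_order R h G) x i.+1 with
    | Some (Some y, s) => local1p_loop R x N.+1 n (tree_path G s y :: h)
        (reverse_path G (tree_path G s y))
        (rcons tr Step ++ search_trace s
           ++ [seq AccessEdge e | e <- tree_path G s y])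
    | Some (None, s) => ret (Some (Outcome (Some (tree_vertices s))
        (rcons tr Step ++ search_trace s)))
    | None => ret None
    end <= (stops_in G (scan_order R h G) x S i.+1)%:R
           + (n * nu)%:R / N.+1%:R)%R.
  have frac_ge0 : (0 <= (n * nu)%:R / N.+1%:R :> rat)%R.
    by rewrite divr_ge0 ?ler0n.
  rewrite /stops_in.
  have [o [s [-> post]]] := dfs_spec x (scan_orderP R h G) (ltn0Sn i).
  case: o post => [y|] post /=; last by rewrite add0r.
  have [wp up _] := tree_pathP post.
  have := cut_size_reverse S wp up; have := vol_out_reverse S wp up.
  rewrite xS; case: (y \in S) => /= vol_S' cut_S'.
    by apply: le_trans (Pr_le1 _ _) _; rewrite lerDl.
  by rewrite add0r; apply: IHn; lia.
apply: le_trans (ler_sum _ (fun i _ => step i)) _.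
(* The constant terms sum to [n * nu] and the indicators to at most [vol_out G S <= nu]. *)
rewrite big_split /= sumr_const card_ord -natr_sum.
rewrite -[((_ / _) *+ _)%R]mulr_natr divfK ?pnatr_eq0 //.
rewrite -natrD ler_nat mulSn leq_add2r.
by apply: leq_trans vol_S; apply: sum_stops_in; apply: scan_orderP.
Qed.

Lemma trivial_cutP G k : 0 < k ->
  x \in trivial_cut x G k /\ cut_size G (trivial_cut x G k) < k.
Proof.
rewrite /trivial_cut; case: pickP => [v /andP[_ cut_v] _|_ k_gt0].
  split=> //; rewrite /trivial_side.
  case: eqP => [_|/eqP vx]; first exact: set11.
  by rewrite !inE eq_sym.
split; first exact: in_setT.
by rewrite (eqP (introT (cut_size0P _ _) _)) // => e; rewrite !inE.
Qed.

End MainLoop.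

(** * Guarantees of the whole algorithm *)

Section Core.

Variables (V E : finType) (R : dfs_rule V E) (x : V) (G : digraph V E).

Lemma local1p_core_always nu k : 0 < nu -> k <= min_outdeg G x ->
  always (fun r => if r is Some o then
      [/\ run_time o <= 64 * (nu * k ^ 2),
          #|accessed_vertices o| <= 9 * (nu * k)
        & forall S, answer o = Some S -> x \in S /\ cut_size G S < k]
    else False) (local1p_core R x G nu k).
Proof.
(* The value 0 occurs when [k] is replaced by a minimum out-degree of 0; the core then does no
   work. *)
move=> nu_gt0; case: k => [|k] le_k /=.
  by split=> //; rewrite /accessed_vertices /= set_nil cards0.
have deg_k v : v != x -> k < outdeg G v.
  by move=> _; apply: leq_trans le_k (min_outdeg_le _ _ _).
apply: always_impl (local1p_loop_always R k [::] [::] nu_gt0 (ltn0Sn k) deg_k).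
case=> // o [time vert cut]; split=> //.
  by apply: leq_trans time _; rewrite /=; lia.
apply: leq_trans vert _; rewrite /vertices_of /= set_nil cards0.
rewrite add0n mulnA [9 * nu * _]mulnC leq_mul2l /=; lia.
Qed.

End Core.

Theorem theorem4 (R : forall V E : finType, dfs_rule V E) (c : nat) :
  LocalEC c (Local1p R)
  /\ has_complexity c (Local1p R)
       (fun nu k => nu * k ^ 2) (fun nu k => nu * k ^ 2) (fun nu k => nu * k).
Proof.
(* 64 for the core and one for the [Step] that supplies the trivial cut. *)
split; last exists 65.
all: move=> V E G x nu k nu_gt0 k_gt0 _; rewrite /Local1p /local1p_graph.
all: case: ltnP => [lt_k|le_k].
(* The fallback replaces every bottom by a set, so the failure probability is 0. *)
- split; last by rewrite Pr_rmap0 // => -[].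
  apply/always_rmap/(always_impl _ (local1p_core_always _ nu_gt0 (leqnn _))).
  move=> [o|//] [_ _ ans] S /= [<-]; case: (answer o) ans => [S'|] ans /=.
    by have [//|xS cut_S] := ans S'; split=> //; apply: ltn_trans lt_k.
  exact: trivial_cutP.
- split=> [|[S [xS vol_S cut_S]]].
    apply: (always_impl _ (local1p_core_always _ nu_gt0 le_k)).
    by move=> [o|//] [].
  case: k k_gt0 le_k cut_S => // n _ _ cut_S; rewrite /local1p_core.
  have lt_nu : nu < 8 * nu * n.+1 by nia.
  apply: le_trans (Pr_local1p_loop _ _ _ lt_nu xS vol_S cut_S) _.
  (* Here [k = n.+1], and [n * nu] is at most an eighth of [8 * nu * n.+1]. *)
  rewrite ler_pdivrMr ?ltr0n; last by lia.
  rewrite mulrAC mul1r ler_pdivlMr // -natrM ler_nat.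
  by nia.
- apply/always_rmap/(always_impl _ (local1p_core_always _ nu_gt0 (leqnn _))).
  move=> [o|//] [time vert _] /=; set o' := Outcome _ _.
  have time' : run_time o' <= 65 * (nu * k ^ 2).
    rewrite /run_time size_rcons; apply: leq_ltn_trans time _.
    have : min_outdeg G x ^ 2 <= k ^ 2 by rewrite leq_sqr ltnW.
    have : 0 < nu * k ^ 2 by rewrite muln_gt0 nu_gt0 expn_gt0 k_gt0.
    by nia.
  split=> //; first exact: leq_trans (card_accessed_edges _) time'.
  rewrite -[accessed_vertices _]/(vertices_of _) vertices_of_rcons.
  by apply: leq_trans vert _; nia.
- apply: (always_impl _ (local1p_core_always _ nu_gt0 le_k)).
  move=> [o|//] [time vert _] /=.
  have time' : run_time o <= 65 * (nu * k ^ 2) by lia.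
  split=> //; first exact: leq_trans (card_accessed_edges _) time'.
  by lia.
Qed.
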